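(* Let $\Sigma$ be a non-lacunary semigroup of $\mathbb{N}$ and let $P\in\mathbb{R}[t]$ be a polynomial with at least one non-constant irrational coefficient (that is, the coefficient of $t^j$ in $P$ is irrational for some $j\ge 1$). Then the set $\{P(s)\colon s\in\Sigma\}$, taken modulo $1$, is dense in $\mathbb{T}$.
   Context: $\mathbb{N}$ denotes the set of positive integers and $\mathbb{T}=\mathbb{R}/\mathbb{Z}$; real numbers are regarded as elements of $\mathbb{T}$ by reduction modulo $1$. A semigroup of $\mathbb{N}$ is a sub-semigroup of $(\mathbb{N},\cdot)$. Two integers $p,q\ge 2$ are multiplicatively independent if their only common power is $1$, i.e. there are no $a,b\in\mathbb{N}$ with $p^a=q^b$. A semigroup of $\mathbb{N}$ is non-lacunary if it contains two multiplicatively independent integers (equivalently, it is not contained in the set of powers of a single integer). *)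

(* Defs.v *)
From HB Require Import structures.
From mathcomp Require Import all_boot all_order all_algebra.
From mathcomp Require Import all_classical all_reals all_analysis.

Set Implicit Arguments.
Unset Strict Implicit.
Unset Printing Implicit Defensive.

Import Order.TTheory GRing.Theory Num.Theory.
Import numFieldNormedType.Exports.

Local Open Scope classical_set_scope.
Local Open Scope ring_scope.
Local Open Scope quotient_scope.

(* [Num.int_num_subdef] is the predicate underlying [Num.int]. *)
Definition int_subgroup (R : realType) : zmodClosed R :=
  GRing.ZmodClosed.clone R (@Num.int_num_subdef R) _.

Definition circle_quot (R : realType) := Quotient.quot (int_subgroup R).

Definition circle (R : realType) : topologicalType :=
  quotient_topology (circle_quot R).

Definition mod1 (R : realType) (x : R) : circle R := \pi_(circle_quot R) x.

Lemma mod1_eq (R : realType) (x y : R) :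
  mod1 x = mod1 y <-> x - y \is a Num.int.
Proof.
have E : (x - y \is a Num.int) = (x == y %[mod circle_quot R]) :=
  Quotient.idealrBE (int_subgroup R) x y.
by rewrite E; split => [h|/eqP h]; [apply/eqP|].
Qed.

Lemma mod1_continuous (R : realType) : continuous (@mod1 R).
Proof. exact: pi_continuous. Qed.

Definition nat_semigroup (S : set nat) : Prop :=
  (forall n, S n -> (0 < n)%N) /\ (forall m n, S m -> S n -> S (m * n)%N).

Definition mult_independent (p q : nat) : Prop :=
  [/\ (2 <= p)%N, (2 <= q)%N &
      ~ exists a b : nat, [/\ (0 < a)%N, (0 < b)%N & (p ^ a = q ^ b)%N]].

Definition non_lacunary (S : set nat) : Prop :=
  exists p q : nat, [/\ S p, S q & mult_independent p q].

(* Main.v *)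
Require Import Defs.
From mathcomp Require Import all_boot all_order all_algebra.
From mathcomp Require Import all_classical all_reals all_analysis.
From mathcomp Require Import cyclic ring lra.

(** The polynomial is linearised on a torus.  Let [d] be the size of [P] and
let [al] be the point of R^d whose coordinates are the coefficients of
t, t^2, ..., t^d.  An integer [s] acts on R^d by diag(s, s^2, ..., s^d); this
is [act s], it preserves the lattice Z^d, and up to the constant term [P(s)]
is the sum of the coordinates of [act s al].  So let [X] be the closure of the
orbit of [al] modulo Z^d, viewed as a closed Z^d-periodic subset of R^d stable
under the semigroup.  It is enough that the coordinate sums of points of [X]
are dense modulo 1.  The proof adapts Boshernitzan's elementary argument for
Furstenberg's theorem on the circle; it rests on two facts.

Expansion ([stable_axis]).  Let [A] be closed, periodic, stable under two
multiplicatively independent integers, and suppose that nonzero points of [A]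
accumulate at 0.  Then [A] contains a whole coordinate axis.  Indeed the
numbers p^i q^j are multiplicatively dense at infinity
([semigroup_log_dense]); blowing up points of [A] close to 0 by such numbers
and passing to the limit gives a curve (u c_1, u^2 c_2, ..., u^d c_d), u > 0,
inside [A] with c != 0 ([expanding_limit]).  Since the exponents are distinct,
modulo Z^d this curve is dense in the subtorus spanned by the coordinates where
[c] does not vanish ([monomial_curve_dense]).

Recurrence ([diff_set_clusters_at0]).  If [A] is periodic, nonempty, stable
under [p] and [q], and has no point that is periodic modulo Z^d both under a
power of [p] and under a power of [q], then the differences of points of [A]
accumulate at 0, because some orbit in [A] is infinite modulo Z^d.

Let [X'] be the set of limit points of [X]; it is nonempty because [al] has an
irrational coordinate.

If [X'] contains a jointly periodic point [r], then the translate of [X] by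
[- r] is stable under powers of [p] and [q] and accumulates at 0, so by
expansion [X] contains a line parallel to an axis through [r], on which the
coordinate sum is onto ([jointly_periodic_limit_axis]).

If not, take [N] coprime to [p q] and replace [p] and [q] by powers congruent to
1 modulo [N].  By recurrence and expansion the difference set of every nonempty
closed stable periodic subset [B] of [X'] contains an axis, hence a vector
[e_j / N] for some [j].  As [e_j / N] is fixed by the action modulo Z^d, the
set of [x] in [B] with [x + e_j / N] in [B] is again such a subset.  Each
iteration shifts the coordinate sum by 1/N, whichever [j] occurs; so after
[N] iterations ([boshernitzan_chain]) the sums over [X'] meet a full coset of
(1/N) Z / Z.  Since [N] is arbitrarily large the sums are dense modulo 1. *)

Set Implicit Arguments.
Unset Strict Implicit.
Unset Printing Implicit Defensive.

Import Order.TTheory GRing.Theory Num.Theory.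
Import numFieldNormedType.Exports.

Local Open Scope classical_set_scope.
Local Open Scope ring_scope.

(** * Row vectors modulo the integer lattice *)

Section RowVectors.
Variables (R : realType) (d : nat).
Implicit Types (x y z : 'rV[R]_d) (A : set 'rV[R]_d) (e : R).

Lemma row_norm_lt x e : 0 < e -> (`|x| < e) <-> (forall j, `|x 0 j| < e).
Proof.
move=> e0; rewrite [`|x|]mx_normrE; split=> [/bigmax_ltP[_ h] j|h].
  exact: (h (0, j)).
by apply/bigmax_ltP; split=> // -[i j] _ /=; rewrite (ord1 i).
Qed.

Lemma row_norm_le x e : 0 <= e -> (`|x| <= e) <-> (forall j, `|x 0 j| <= e).
Proof.
move=> e0; rewrite [`|x|]mx_normrE; split=> [/bigmax_leP[_ h] j|h].
  exact: (h (0, j)).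
by apply/bigmax_leP; split=> // -[i j] _ /=; rewrite (ord1 i).
Qed.

Lemma coord_le_norm x j : `|x 0 j| <= `|x|.
Proof. exact: (row_norm_le x (normr_ge0 x)).1. Qed.

Lemma closure_approxP A x : closure A x <->
  forall e, 0 < e -> exists2 y, A y & `|x - y| < e.
Proof.
split=> [cx e e0|h U /nbhs_ballP[e /= e0 eU]].
  have [y [Ay]] := cx _ (nbhsx_ballx x e e0).
  by rewrite -ball_normE => xy; exists y.
have [y Ay xy] := h e e0; exists y; split=> //.
by apply: eU; rewrite -ball_normE.
Qed.

Lemma closed_approxP A :
  closed A <-> forall x, (forall e, 0 < e -> exists2 y, A y & `|x - y| < e) -> A x.
Proof.
by split=> [cA x /closure_approxP/cA//|h x /closure_approxP/h].
Qed.

Lemma limit_point_approxP A x : limit_point A x <->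
  forall e, 0 < e -> exists2 y, A y & y != x /\ `|x - y| < e.
Proof.
split=> [lx e e0|h U /nbhs_ballP[e /= e0 eU]].
  have [y [yx Ay]] := lx _ (nbhsx_ballx x e e0).
  by rewrite -ball_normE => xy; exists y.
have [y Ay [yx xy]] := h e e0; exists y; split=> //.
by apply: eU; rewrite -ball_normE.
Qed.

Lemma row_bolzano_weierstrass (w : nat -> 'rV[R]_d) M : (forall n, `|w n| <= M) ->
  exists c, forall e n, 0 < e -> exists2 m, (n <= m)%N & `|w m - c| < e.
Proof.
move=> wM; pose B := [set x : 'rV[R]_d | `|x| <= M].
have cB : compact B.
  apply: bounded_closed_compact.
    exists M; split; first exact: num_real.
    by move=> M' MM' x /le_trans; apply; exact: ltW.
  apply/closed_approxP => x h; rewrite /B /=.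
  apply/ler_addgt0Pr => e /h[y By xy].
  by rewrite -(subrK y x) addrC (le_trans (ler_normD _ _))// lerD// ltW.
have [|c [_ hc]] := cB (w @ \oo) _; first by exists 0%N => // n _; exact: wM.
exists c => e n e0.
have [||y [[m nm <-]]] := hc (w @` [set m | (n <= m)%N]) (ball c e).
- by exists n => // m /= nm; exists m.
- exact: nbhsx_ballx.
by rewrite -ball_normE /= distrC => h; exists m.
Qed.

Definition int_row x := forall j, x 0 j \is a Num.int.

Lemma int_rowN x : int_row x -> int_row (- x).
Proof. by move=> h j; rewrite mxE rpredN. Qed.

Lemma int_rowD x y : int_row x -> int_row y -> int_row (x + y).
Proof. by move=> hx hy j; rewrite mxE rpredD. Qed.

Lemma int_rowB x y : int_row x -> int_row y -> int_row (x - y).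
Proof. by move=> hx /int_rowN; exact: int_rowD. Qed.

(** The compactness of the torus, for lifts to R^d: the clustering translates
of the sequence come with explicit lattice vectors. *)
Lemma row_bolzano_weierstrass_mod1 (w : nat -> 'rV[R]_d) :
  exists c, forall e n, 0 < e ->
    exists2 m, (n <= m)%N & exists2 z, int_row z & `|w m - z - c| < e.
Proof.
pose f n : 'rV[R]_d := \row_j (Num.floor (w n 0 j))%:~R.
have fint n : int_row (f n) by move=> j; rewrite mxE intr_int.
have [|c hc] := @row_bolzano_weierstrass (fun n => w n - f n) 1.
  move=> n; apply/row_norm_le => // j; rewrite !mxE.
  have /andP[h1 h2] := floor_itv (w n 0 j).
  by rewrite ger0_norm ?subr_ge0// lerBlDl -[leRHS]intrD1 ltW.
by exists c => e n /hc-/(_ n)[m nm h]; exists m => //; exists (f m).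
Qed.

End RowVectors.

(** * Multiplicative density of two independent integers *)

Section LogDensity.
Variable R : realType.
Implicit Types (x y e t : R).

(** If the step d = a x - b y is positive and at most [e], then replacing i
blocks b y by blocks a x moves M (b y) forward by i d; once M is large, these
moves fill the whole gap up to (M + 1) (b y). *)
Lemma comb_eventually_dense x y e (a b : nat) :
  0 < b%:R * y -> 0 < a%:R * x - b%:R * y <= e ->
  exists t0, forall t, t0 <= t -> 
    exists i j : nat, t <= i%:R * x + j%:R * y <= t + e.
Proof.
set L := b%:R * y; set del := a%:R * x - L => L0 /andP[d0 de].
have LV : 0 < L^-1 by rewrite invr_gt0.
have dV : 0 < del^-1 by rewrite invr_gt0.
pose K := (Num.truncn (L / del)).+1.
exists (L * K%:R) => t ht.
have K0 : 0 < K%:R :> R by rewrite ltr0n.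
have t0 : 0 <= t by apply: le_trans ht; rewrite mulr_ge0// ltW.
pose M := Num.truncn (t / L).
have /andP[M1 M2] : M%:R <= t / L < M.+1%:R by apply/truncn_itv; rewrite mulr_ge0// ltW.
rewrite ler_pdivlMr// in M1; rewrite ltr_pdivrMr// in M2.
pose i := Num.truncn ((t - M%:R * L) / del).
have /andP[i1 i2] : i%:R <= (t - M%:R * L) / del < i.+1%:R.
  by apply/truncn_itv; rewrite mulr_ge0 ?subr_ge0// ltW.
have KM : (K <= M)%N.
  by rewrite -ltnS -(ltr_nat R) -(ltr_pM2l L0) (le_lt_trans ht)// mulrC.
have iK : (i.+1 <= K)%N.
  rewrite -(ltr_nat R); apply: le_lt_trans i1 _.
  have /andP[_] := truncn_itv (ltW (mulr_gt0 L0 dV)); apply: le_lt_trans.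
  rewrite ler_pM2r// lerBlDr; move: M2; rewrite -natr1; lra.
rewrite ler_pdivlMr// in i1; rewrite ltr_pdivrMr// in i2.
exists (i.+1 * a)%N, ((M - i.+1) * b)%N.
have -> : (i.+1 * a)%:R * x + ((M - i.+1) * b)%:R * y = M%:R * L + i.+1%:R * del.
  rewrite !natrM natrB ?(leq_trans iK KM)//.
  by rewrite /del /L; ring.
apply/andP; split; first by rewrite -lerBlDl ltW.
by rewrite -natr1; lra.
Qed.

(** Rational independence gives small nonzero values of a x - b y with
a, b > 0: apply the pigeonhole principle to the multiples of x / y modulo 1.
The sign of the small value decides which of [x], [y] is traded for the
other. *)
Lemma additive_comb_dense x y e : 0 < x -> 0 < y -> 0 < e ->
  (forall a b : nat, (0 < a)%N -> (0 < b)%N -> a%:R * x != b%:R * y) ->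
  exists t0, forall t, t0 <= t ->
    exists i j : nat, t <= i%:R * x + j%:R * y <= t + e.
Proof.
move=> x0 y0 e0 irr.
(* The bound [x] on the small value forces its coefficient k to be positive. *)
pose r := Num.min e x / y / 2.
have m0 : 0 < Num.min e x by rewrite lt_min e0.
have r0 : 0 < r by rewrite !mulr_gt0 ?invr_gt0.
have [c hc] := row_bolzano_weierstrass_mod1 (fun n => (const_mx (n%:R * x / y) : 'rV[R]_1)).
have [n _ [z iz hz]] := hc _ 0%N r0.
have [m nm [z' iz' hz']] := hc _ n.+1 r0.
have [a Ea a0] : exists2 a, m = (n + a)%N & (0 < a)%N.
  by exists (m - n)%N; rewrite ?subn_gt0// subnKC// ltnW.
have /intrP[k Ek] : z' 0 0 - z 0 0 \is a Num.int by rewrite rpredB.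
have H : `|a%:R * x - k%:~R * y| < Num.min e x.
  move/row_norm_lt: hz => /(_ r0 0); move/row_norm_lt: hz' => /(_ r0 0).
  rewrite !mxE => h1 h2.
  have -> : a%:R * x - k%:~R * y = y * ((m%:R * x / y - z' 0 0 - c 0 0) -
         (n%:R * x / y - z 0 0 - c 0 0)).
    by rewrite -Ek Ea natrD; field; rewrite gt_eqF.
  rewrite normrM (gtr0_norm y0) mulrC -ltr_pdivlMr//.
  have -> : Num.min e x / y = r + r by rewrite /r; field; rewrite gt_eqF.
  by apply: le_lt_trans (ler_normB _ _) _; exact: ltrD.
move: H; rewrite lt_min => /andP[He Hx].
have ax : x <= a%:R * x by rewrite ler_peMl ?ler1n// ltW.
have ky : 0 < k%:~R * y.
  by move: Hx; rewrite ltr_norml => /andP[_]; lra.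
have k0 : 0 < k by rewrite -(ltr0z R) -(pmulr_lgt0 _ y0).
case: k k0 ky He {Hx Ek} => // b; rewrite ltz_nat -pmulrn => b0 by0 He.
have := irr a b a0 b0; rewrite neq_lt => /orP[lt|gt].
  have [||t0 h] := @comb_eventually_dense y x e b a.
  - by rewrite mulr_gt0 ?ltr0n.
  - by rewrite subr_gt0 lt /= ltW// (le_lt_trans _ He)// distrC ler_norm.
  by exists t0 => t /h[i [j]]; rewrite addrC => hij; exists j, i.
apply: (@comb_eventually_dense x y e a b) => //.
by rewrite subr_gt0 gt /= ltW// (le_lt_trans _ He)// ler_norm.
Qed.

Lemma mult_independent_exp (p q u v : nat) : mult_independent p q ->
  (0 < u)%N -> (0 < v)%N -> mult_independent (p ^ u) (q ^ v).
Proof.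
move=> [p2 q2 ind] u0 v0; split.
- by rewrite -(exp1n u) ltn_exp2r.
- by rewrite -(exp1n v) ltn_exp2r.
move=> [a [b [a0 b0 E]]]; apply: ind; exists (u * a)%N, (v * b)%N.
by rewrite !muln_gt0 u0 v0 a0 b0 !expnM.
Qed.

Lemma mult_independent_log (p q a b : nat) : mult_independent p q ->
  (0 < a)%N -> (0 < b)%N -> a%:R * ln p%:R != b%:R * ln q%:R :> R.
Proof.
move=> [p2 q2 ind] a0 b0; apply/eqP => E; apply: ind; exists a, b; split=> //.
have pp : 0 < p%:R :> R by rewrite ltr0n ltnW.
have qp : 0 < q%:R :> R by rewrite ltr0n ltnW.
apply/eqP; rewrite -(eqr_nat R) !natrX; apply/eqP.
have [pa qb] : 0 < p%:R ^+ a :> R /\ 0 < q%:R ^+ b :> R by rewrite !exprn_gt0.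
apply: (ln_inj pa qb); rewrite (lnXn a pp) (lnXn b qp).
by rewrite -[LHS]mulr_natl -[RHS]mulr_natl; exact: E.
Qed.

(** The overshoot is measured on the k-th power since the action multiplies
the coordinates by powers up to the dimension. *)
Lemma semigroup_log_dense (p q k : nat) e : mult_independent p q -> 0 < e ->
  exists2 t0, 0 < t0 & forall t, t0 <= t -> exists i j : nat,
    t <= (p ^ i * q ^ j)%:R /\ ((p ^ i * q ^ j)%:R / t) ^+ k <= 1 + e.
Proof.
move=> ind e0; have [p2 q2 _] := ind.
have [p1 q1] : 1 < p%:R :> R /\ 1 < q%:R :> R by rewrite !ltr1n.
have [pp qp] : 0 < p%:R :> R /\ 0 < q%:R :> R by split; exact: lt_trans ltr01 _.
have l0 : 0 < ln (1 + e) / k.+1%:R by rewrite divr_gt0// ln_gt0// ltrDl.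
have [|t0 h] := additive_comb_dense (ln_gt0 p1) (ln_gt0 q1) l0.
  by move=> a b; exact: mult_independent_log.
exists (expR t0); first exact: expR_gt0.
move=> t ht; have tp : 0 < t by apply: lt_le_trans ht; exact: expR_gt0.
have [|i [j /andP[h1 h2]]] := h (ln t).
  by rewrite -[t0]expRK ler_ln ?posrE ?expR_gt0.
exists i, j; set s := (_ * _)%N.
have s0 : 0 < s%:R :> R by rewrite natrM !natrX mulr_gt0 ?exprn_gt0.
have Es : ln s%:R = i%:R * ln p%:R + j%:R * ln q%:R :> R.
  by rewrite natrM !natrX lnM ?posrE ?exprn_gt0// (lnXn _ pp) (lnXn _ qp) !mulr_natl.
rewrite -Es in h1 h2; split; first by rewrite -ler_ln ?posrE.
have e1 : 0 < 1 + e by rewrite addr_gt0.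
rewrite -ler_ln ?posrE ?exprn_gt0 ?divr_gt0// lnXn ?divr_gt0// ln_div ?posrE//.
have h3 : ln s%:R - ln t <= ln (1 + e) / k.+1%:R by rewrite lerBlDl.
rewrite -[_ *+ k]mulr_natl; apply: (@le_trans _ _ (k%:R * (ln (1 + e) / k.+1%:R))).
  by rewrite ler_wpM2l.
rewrite mulrCA ler_piMr ?ln_ge0// ?lerDl ?ltW// ltr_pdivrMr ?mul1r ?ltr_nat//.
Qed.
End LogDensity.

(** * Density of monomial curves modulo 1 *)

Section Curve.
Variable R : realType.
Implicit Types (c w : nat -> R) (e u : R).

Lemma exprn_root (n : nat) u : 0 <= u -> exists2 v : R, 0 <= v & v ^+ n.+1 = u.
Proof.
move=> u0; exists (u `^ n.+1%:R^-1); first exact: powR_ge0.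
by rewrite -powR_mulrn ?powR_ge0// -powRrM mulVf ?pnatr_eq0// powRr1.
Qed.

(** A bounded increment of the top power changes the lower powers by at most
a multiple of 1/u.  This decouples the coordinates of a monomial curve far
out. *)
Lemma shift_root (k : nat) u h : 1 <= u -> 0 <= h -> exists v, [/\ u <= v,
  v ^+ k.+1 = u ^+ k.+1 + h &
  forall j, (j < k)%N -> (v ^+ j.+1 - u ^+ j.+1) * u <= h].
Proof.
move=> u1 h0; have u0 : 0 <= u := le_trans ler01 u1.
have [|v v0 Ev] := @exprn_root k (u ^+ k.+1 + h); first by rewrite addr_ge0// exprn_ge0.
have uv : u <= v by rewrite -(@ler_pXn2r _ k.+1)// ?nnegrE// Ev lerDl.
exists v; split=> // j jk.
have le_up : (v ^+ j.+1 - u ^+ j.+1) * u <= (v ^+ j.+1 - u ^+ j.+1) * u ^+ (k - j).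
  rewrite ler_wpM2l ?subr_ge0 ?lerXn2r ?nnegrE// -{1}[u]expr1 ler_weXn2l//.
  by rewrite subn_gt0.
apply: le_trans le_up _; rewrite mulrBl -exprD addSn subnKC ?(ltnW jk)//.
rewrite lerBlDl -Ev -{2}(subnKC (ltnW jk)) -addSn exprD.
by rewrite ler_wpM2l ?exprn_ge0// lerXn2r ?nnegrE.
Qed.

(** Induction on the number of coordinates.  After the lower coordinates have
been placed at a large parameter, the top coordinate is corrected exactly by an
increment of at most 1 of its value, which by [shift_root] hardly moves the
lower ones.  Coordinates with [c j = 0] are stuck at 0, hence the condition on
the target [w]. *)
Lemma monomial_curve_dense c w : (forall j, c j = 0 -> w j = 0) ->
  forall (k : nat) e U, 0 < e -> exists2 u, 0 < u /\ U <= u &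
    forall j, (j < k)%N -> exists m : int, `|u ^+ j.+1 * c j - w j - m%:~R| < e.
Proof.
move=> cw; elim=> [|k IH] e U e0.
  by exists (Num.max 1 U) => //; rewrite lt_max ltr01 le_max lexx orbT.
have [ck|ck] := eqVneq (c k) 0.
  have [u hu h] := IH e U e0; exists u => // j; rewrite ltnS leq_eqVlt.
  by case/predU1P=> [->|/h//]; exists 0; rewrite cw// ck mulr0 !subr0 normr0.
have a0 : 0 < `|c k| by rewrite normr_gt0.
(* [B] bounds every lower coefficient at once. *)
pose B := \sum_(j < k) `|c j|.
have B0 : 0 <= B by apply: sumr_ge0.
have e2 : 0 < e / 2 by rewrite divr_gt0.
have [u [u0]] := IH (e / 2) (Num.max 1 (Num.max U (B / `|c k| / (e / 2)))) e2.
rewrite !ge_max => /and3P[u1 Uu Bu] hu.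
pose g := Num.sg (c k); pose v := u ^+ k.+1 * c k - w k.
pose m := Num.floor (g * v) + 1.
(* Multiplying by the sign [g] makes the correction m - g v nonnegative
   whatever the sign of [c k], so that the parameter only increases. *)
have [d0 d1] : 0 <= m%:~R - g * v /\ m%:~R - g * v <= 1.
  have /andP[f1 f2] := floor_itv (g * v).
  split; first by rewrite subr_ge0 ltW.
  by rewrite /m intrD mulr1z; move: f1; lra.
have gg : g * g = 1 by rewrite /g -expr2 sqr_sg ck.
have h0 : 0 <= (m%:~R - g * v) / `|c k| by rewrite divr_ge0.
have [u' [uu' Eu' hu']] := shift_root k u1 h0.
exists u'; first by rewrite (lt_le_trans u0)// (le_trans Uu).
move=> j; rewrite ltnS leq_eqVlt => /predU1P[->|jk].
  exists (sgz (c k) * m); rewrite intrM -sgrEz -/g Eu'.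
  suff -> : (u ^+ k.+1 + (m%:~R - g * v) / `|c k|) * c k - w k - g * m%:~R = 0.
    by rewrite normr0.
  rewrite mulrDl.
  have -> : (m%:~R - g * v) / `|c k| * c k = g * m%:~R - g * g * v.
    by rewrite {2}[c k]numEsg -/g; field; exact: lt0r_neq0.
  by rewrite gg /v; ring.
have [n hn] := hu j jk; exists n.
have -> : u' ^+ j.+1 * c j - w j - n%:~R =
  (u ^+ j.+1 * c j - w j - n%:~R) + (u' ^+ j.+1 - u ^+ j.+1) * c j by ring.
apply: le_lt_trans (ler_normD _ _) _; rewrite [e]splitr; apply: ltr_leD => //.
have D0 : 0 <= u' ^+ j.+1 - u ^+ j.+1.
  by rewrite subr_ge0 lerXn2r ?nnegrE// ltW// (lt_le_trans u0).
rewrite normrM (ger0_norm D0) -(ler_pM2l u0).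
have cB : `|c j| <= B.
  by rewrite /B (bigD1 (Ordinal jk))//= lerDl sumr_ge0.
rewrite mulrA [u * _]mulrC; apply: (@le_trans _ _ (`|c k|^-1 * B)).
  apply: ler_pM => //; first by rewrite mulr_ge0// ltW.
  apply: le_trans (hu' j jk) _.
  by rewrite -[leRHS]mul1r ler_wpM2r// invr_ge0 ltW.
by rewrite mulrC -ler_pdivrMr// mulrC.
Qed.
End Curve.

(** * The diagonal action and its expanding orbits *)

Section Action.
Variables (R : realType) (d : nat).
Implicit Types (x y z c : 'rV[R]_d) (A : set 'rV[R]_d) (e s t u : R).

Definition act s x : 'rV[R]_d := \row_j (s ^+ j.+1 * x 0 j).

Lemma actM s t x : act (s * t) x = act s (act t x).
Proof. by apply/rowP => j; rewrite !mxE exprMn mulrA. Qed.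

Lemma act1 x : act 1 x = x.
Proof. by apply/rowP => j; rewrite !mxE expr1n mul1r. Qed.

Lemma actD s x y : act s (x + y) = act s x + act s y.
Proof. by apply/rowP => j; rewrite !mxE mulrDr. Qed.

Lemma actB s x y : act s (x - y) = act s x - act s y.
Proof. by apply/rowP => j; rewrite !mxE mulrBr. Qed.

Lemma act_inj s : s != 0 -> injective (act s).
Proof. by move=> s0 x y E; rewrite -[x]act1 -[y]act1 -(mulVf s0) !actM E. Qed.

Lemma norm_act s x : 1 <= s -> `|act s x| <= s ^+ d * `|x|.
Proof.
move=> s1; have s0 : 0 <= s := le_trans ler01 s1.
apply/row_norm_le => [|j]; first by rewrite mulr_ge0 ?exprn_ge0.
rewrite mxE normrM ger0_norm ?exprn_ge0// ler_pM ?exprn_ge0// ?coord_le_norm//.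
exact: ler_weXn2l.
Qed.

Lemma int_row_act (n : nat) z : int_row z -> int_row (act n%:R z).
Proof. by move=> iz j; rewrite mxE rpredM// rpredX// natr_int. Qed.

Definition int_periodic A := forall x z, A x -> int_row z -> A (x + z).

Definition stable (n : nat) A := forall x, A x -> A (act n%:R x).

Lemma stable_exp n k A : stable n A -> stable (n ^ k) A.
Proof.
move=> sA; elim: k => [|k IH] x Ax; first by rewrite expn0 act1.
by rewrite expnS natrM actM; exact/sA/IH.
Qed.

Lemma stableM m n A : stable m A -> stable n A -> stable (m * n) A.
Proof. by move=> sm sn x Ax; rewrite natrM actM; exact/sm/sn. Qed.

Definition l1norm x := \sum_j `|x 0 j|.

Lemma l1norm_le x : l1norm x <= d%:R * `|x|.
Proof.
apply: (@le_trans _ _ (\sum_(j < d) `|x|)); last first.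
  by rewrite sumr_const card_ord mulr_natl.
by apply: ler_sum => j _; exact: coord_le_norm.
Qed.

(** The coordinates of [act t x] grow at different rates, so the scale of a
small vector is defined implicitly, by asking its image to have unit l1 norm;
the intermediate value theorem for polynomials provides it. *)
Lemma rescale x T : x != 0 -> 1 <= T -> d%:R * (T ^+ d * `|x|) <= 1 ->
  exists2 t, T <= t & l1norm (act t x) = 1.
Proof.
move=> x0 T1 xT.
have [j xj] : exists j, x 0 j != 0.
  apply: contrapT => h; move/eqP: x0; apply; apply/rowP => j; rewrite mxE.
  by apply/eqP/negPn/negP => xj; apply: h; exists j.
pose Q : {poly R} := \sum_(i < d) `|x 0 i| *: 'X^(i.+1) - 1%:P.
have QE t : 0 <= t -> Q.[t] = l1norm (act t x) - 1.
  move=> t0; rewrite /Q !hornerE horner_sum; congr (_ - _).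
  apply: eq_bigr => i _; rewrite !hornerE mxE normrM (ger0_norm (exprn_ge0 _ t0)).
  by rewrite mulrC.
have T0 : 0 <= T := le_trans ler01 T1.
pose b := Num.max T `|x 0 j|^-1.
have Tb : T <= b by rewrite le_max lexx.
have b1 : 1 <= b := le_trans T1 Tb.
have [|t /andP[Tt tb]] := @poly_ivt R Q T b Tb; last first.
  rewrite rootE QE ?(le_trans T0)// subr_eq0 => /eqP h.
  by exists t.
rewrite !QE ?(le_trans T0 Tb)// subr_le0 subr_ge0; apply/andP; split.
  apply: le_trans (l1norm_le _) _; apply: le_trans xT.
  by rewrite ler_wpM2l// norm_act.
rewrite /l1norm (bigD1 j)//= ler_wpDr ?sumr_ge0// mxE normrM.
have b0 : 0 <= b := le_trans T0 Tb.
rewrite (ger0_norm (exprn_ge0 _ b0)) -ler_pdivrMr ?normr_gt0// div1r.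
by rewrite (@le_trans _ _ b)// ?le_max ?lexx ?orbT// ler_eXnr.
Qed.

Lemma act_near u c e : 0 < u -> 0 < e -> exists2 h, 0 < h &
  forall v y, 1 <= v -> v ^+ d <= 1 + h -> `|y - c| < h ->
    `|act u c - act (u * v) y| < e.
Proof.
move=> u0 e0; pose K := Num.max 1 u ^+ d.
have K0 : 0 < K by rewrite exprn_gt0// lt_max ltr01.
have c0 : 0 < `|c| + 2 by rewrite ltr_wpDl.
pose h := Num.min 1 (e / (K * (`|c| + 2)) / 2).
have h0 : 0 < h by rewrite lt_min ltr01 !divr_gt0// mulr_gt0.
have h1 : h <= 1 by rewrite ge_min lexx.
have he : K * (h * (`|c| + 2)) < e.
  rewrite mulrCA -ltr_pdivlMr ?mulr_gt0//.
  apply: (@le_lt_trans _ _ (e / (K * (`|c| + 2)) / 2)).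
    by rewrite ge_min lexx orbT.
  by rewrite gtr_pMr ?divr_gt0 ?mulr_gt0// invf_lt1// ltr1n.
exists h => // v y v1 vd yc; apply/row_norm_lt => // j; rewrite !mxE.
apply: le_lt_trans he.
have v0 : 0 <= v := le_trans ler01 v1.
have vj : 1 <= v ^+ j.+1 <= 1 + h.
  by rewrite exprn_ege1// (le_trans _ vd)// ler_weXn2l.
have uK : u ^+ j.+1 <= K.
  apply: (@le_trans _ _ (Num.max 1 u ^+ j.+1)).
    by rewrite lerXn2r ?nnegrE ?le_max ?lexx ?orbT ?ler01// ltW.
  by rewrite ler_weXn2l// le_max lexx.
have -> : u ^+ j.+1 * c 0 j - (u * v) ^+ j.+1 * y 0 j =
   - (u ^+ j.+1 * (v ^+ j.+1 * (y 0 j - c 0 j) + (v ^+ j.+1 - 1) * c 0 j)).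
  by rewrite exprMn; ring.
rewrite normrN normrM ger0_norm ?exprn_ge0 ?(ltW u0)//.
apply: ler_pM; rewrite ?exprn_ge0 ?(ltW u0)//.
have yj : `|y 0 j - c 0 j| <= h.
  by apply: le_trans (ltW yc); have := coord_le_norm (y - c) j; rewrite !mxE.
have cj := coord_le_norm c j; case/andP: vj => vj1 vj2.
apply: le_trans (ler_normD _ _) _; rewrite !normrM.
rewrite (ger0_norm (exprn_ge0 _ v0)) (ger0_norm (_ : 0 <= _ - 1)) ?subr_ge0//.
apply: (@le_trans _ _ ((1 + h) * h + h * `|c|)).
  by apply: lerD; apply: ler_pM; rewrite ?subr_ge0 ?exprn_ge0// lerBlDl.
by rewrite [h * `|c|]mulrC -mulrDl mulrC ler_pM2l//; lra.
Qed.

Definition clusters_at0 A :=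
  forall e, 0 < e -> exists2 x, A x & x != 0 /\ `|x| < e.

(** Points x_n of [A] tending to 0 are rescaled to unit norm by reals t_n
tending to infinity; [c] is a cluster point of the rescaled vectors y_n.  For
u > 0 choose s_n = p^i q^j with s_n / (u t_n) close to 1: then
act s_n x_n = act (s_n / t_n) y_n lies in [A] and is close to [act u c]. *)
Lemma expanding_limit A p q : mult_independent p q ->
  closed A -> stable p A -> stable q A ->
  clusters_at0 A ->
  exists2 c, c != 0 & forall u, 0 < u -> A (act u c).
Proof.
move=> ind /closed_approxP cA sp sq acc.
(* The smallness of x makes its scale t at least n + 1. *)
have step (n : nat) : exists ty : R * 'rV[R]_d,
    [/\ n.+1%:R <= ty.1, A (act ty.1^-1 ty.2) & l1norm ty.2 = 1].
  have M0 : 0 < (d.+1%:R * n.+1%:R ^+ d)^-1 :> R.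
    by rewrite invr_gt0 mulr_gt0 ?ltr0n ?exprn_gt0.
  have [x Ax [x0 xM]] := acc _ M0.
  have [|||t nt tx] := @rescale x n.+1%:R => //; first by rewrite ler1n.
    rewrite mulrA; apply: (@le_trans _ _ (d.+1%:R * n.+1%:R ^+ d * `|x|)).
      by rewrite ler_wpM2r// ler_wpM2r ?exprn_ge0// ler_nat.
    by rewrite -ler_pdivlMl ?mulr1 ?(ltW xM)// mulr_gt0 ?ltr0n ?exprn_gt0.
  exists (t, act t x); split=> //=; rewrite -actM mulVf ?act1// gt_eqF//.
  by apply: lt_le_trans nt.
have [f hf] := choice step.
have [|c hc] := @row_bolzano_weierstrass R d (fun n => (f n).2) 1.
  move=> n; apply/row_norm_le => // j; have [_ _ <-] := hf n.
  by rewrite /l1norm (bigD1 j)//= lerDl sumr_ge0.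
exists c.
  apply/eqP => c0; have d0 : 0 < d.+1%:R^-1 :> R by rewrite invr_gt0.
  have [n _] := hc _ 0%N d0; rewrite c0 subr0 => small.
  have [_ _ E] := hf n; have := l1norm_le (f n).2; rewrite E leNgt => /negP; apply.
  move: small; rewrite -[d.+1%:R^-1]mul1r ltr_pdivlMr// mulrC; apply: le_lt_trans.
  by rewrite ler_wpM2r// ler_nat.
move=> u u0; apply: cA => e e0.
have [h h0 hh] := act_near c u0 e0.
have [t0 t00 ht0] := semigroup_log_dense d ind h0.
have [n hn yc] := hc _ (Num.truncn (t0 / u)) h0.
have [tn Ay _] := hf n; set t := (f n).1 in tn Ay; set y := (f n).2 in yc Ay.
have tp : 0 < t by apply: lt_le_trans tn.
have tu : t0 <= u * t.
  rewrite mulrC -ler_pdivrMr//; apply: le_trans tn.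
  have /andP[_ /ltW h1] := truncn_itv (ltW (divr_gt0 t00 u0)); apply: le_trans h1 _.
  by rewrite ler_nat ltnS.
have [i [j [h1 h2]]] := ht0 _ tu; set s := (_ * _)%N in h1 h2.
have ut0 : 0 < u * t by rewrite mulr_gt0.
exists (act s%:R (act t^-1 y)).
  exact: (stableM (stable_exp i sp) (stable_exp j sq)).
have -> : act s%:R (act t^-1 y) = act (u * (s%:R / (u * t))) y.
  rewrite -actM; congr act; field; rewrite !gt_eqF//.
by apply: hh => //; rewrite ler_pdivlMr// mul1r.
Qed.

Definition axis j (a : R) : 'rV[R]_d := \row_i (if i == j then a else 0).

(** The limit curve of [expanding_limit], reduced modulo the lattice, comes
arbitrarily close to every point of the axis of a coordinate where [c] does not
vanish. *)
Lemma stable_axis A p q : mult_independent p q ->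
  closed A -> int_periodic A -> stable p A -> stable q A ->
  clusters_at0 A ->
  exists j, forall a, A (axis j a).
Proof.
move=> ind cA pA sp sq acc.
have [c c0 hc] := expanding_limit ind cA sp sq acc.
have [j cj] : exists j, c 0 j != 0.
  apply: contrapT => h; move/eqP: c0; apply; apply/rowP => j; rewrite mxE.
  by apply/eqP/negPn/negP => cj; apply: h; exists j.
exists j => a; move/closed_approxP: (cA); apply => e e0.
(* [monomial_curve_dense] is about sequences: rows are extended by 0. *)
pose ext (x : 'rV[R]_d) (n : nat) := if insub n is Some i then x 0 i else 0.
have extE x (i : 'I_d) : ext x i = x 0 i by rewrite /ext valK.
have [|u [u0 _] hu] := @monomial_curve_dense R (ext c) (ext (axis j a)) _ d e 0 e0.
  move=> n; rewrite /ext; case: insubP => // i _ _; rewrite !mxE.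
  by case: eqVneq => [->/eqP|//]; rewrite (negPf cj).
have [m hm] := choice (fun i : 'I_d => hu i (ltn_ord i)).
exists (act u c + \row_i (- (m i)%:~R)).
  by apply: pA; [exact: hc|move=> i; rewrite mxE rpredN intr_int].
apply/row_norm_lt => // i; have := hm i; rewrite !extE -normrN !mxE.
by congr (`|_| < _); ring.
Qed.

End Action.

(** * Differences, recurrence and the aperiodic case *)

Section Recurrence.
Variables (R : realType) (d : nat).
Implicit Types (x y z v : 'rV[R]_d) (A : set 'rV[R]_d) (e : R).

Definition diff_set A : set 'rV[R]_d := [set v | exists2 x, A x & A (x + v)].

(** By periodicity the base points of the differences can be taken in a bounded
region, where they cluster. *)
Lemma closed_diff_set A : closed A -> int_periodic A -> closed (diff_set A).
Proof.
move=> /closed_approxP cA pA; apply/closed_approxP => v hv.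
have step (n : nat) : exists xy : 'rV[R]_d * 'rV[R]_d,
    [/\ A xy.1, A (xy.1 + xy.2) & `|v - xy.2| < n.+1%:R^-1].
  have [|y [x Ax Axy] vy] := hv n.+1%:R^-1; first by rewrite invr_gt0.
  by exists (x, y).
have [f hf] := choice step.
have [c hc] := row_bolzano_weierstrass_mod1 (fun n => (f n).1).
exists c; apply: cA => e e0; have e2 : 0 < e / 2 by rewrite divr_gt0.
  have [n _ [z iz hz]] := hc _ 0%N e0; have [Ax _ _] := hf n.
  exists ((f n).1 - z); last by rewrite distrC.
  by apply: pA => //; exact: int_rowN.
have [n hn [z iz hz]] := hc _ (Num.truncn (e / 2)^-1) e2.
have [_ Ay yv] := hf n; exists ((f n).1 + (f n).2 - z).
  by apply: pA => //; exact: int_rowN.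
have -> : c + v - ((f n).1 + (f n).2 - z) =
    (v - (f n).2) - ((f n).1 - z - c).
  by rewrite !opprB !opprD; apply/rowP => j; rewrite !mxE; ring.
rewrite (le_lt_trans (ler_normB _ _))// [e]splitr ltrD//.
apply: lt_le_trans yv _; rewrite -[leRHS]invrK lef_pV2 ?posrE ?invr_gt0//.
have ei : 0 < (e / 2)^-1 by rewrite invr_gt0.
have /andP[_ /ltW h] := truncn_itv (ltW ei).
by apply: le_trans h _; rewrite ler_nat ltnS.
Qed.

Lemma int_periodic_diff_set A : int_periodic A -> int_periodic (diff_set A).
Proof. by move=> pA v z [x Ax Axv] iz; exists x => //; rewrite addrA; exact: pA. Qed.

Lemma stable_diff_set n A : stable n A -> stable n (diff_set A).
Proof.
by move=> sA v [x /sA Ax /sA Axv]; exists (act n%:R x) => //; rewrite -actD.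
Qed.

(** Either the orbit is finite modulo the lattice, hence eventually periodic,
or it has two distinct points that are close modulo the lattice. *)
Lemma orbit_recurrence (s : nat) A x : stable s A -> int_periodic A -> A x ->
  (exists k u, (0 < u)%N /\ int_row (act (s ^ (k + u))%:R x - act (s ^ k)%:R x)) \/
  clusters_at0 (diff_set A).
Proof.
move=> sA pA Ax; apply/or_asboolP; rewrite -implyNb; apply/implyP => /asboolPn nper.
apply/asboolP => e e0; have e2 : 0 < e / 2 by rewrite divr_gt0.
pose w n := act (s ^ n)%:R x.
have [c hc] := row_bolzano_weierstrass_mod1 w.
have [n _ [z iz hz]] := hc _ 0%N e2.
have [m nm [z' iz' hz']] := hc _ n.+1 e2.
have Aw k y : int_row y -> A (w k - y).
  by move=> iy; apply: pA; [exact: stable_exp|exact: int_rowN].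
exists ((w m - z') - (w n - z)).
  by exists (w n - z); rewrite ?subrKC; exact: Aw.
split.
  rewrite subr_eq0; apply/eqP => E; apply: nper.
  exists n, (m - n)%N; rewrite subn_gt0 subnKC ?(ltnW nm)//; split=> //.
  rewrite -/(w m) -/(w n).
  have -> : w m - w n = z' - z.
    by rewrite -[w m](subrK z') E addrAC [w n - z]addrC addrK addrC.
  exact: int_rowB.
have -> : w m - z' - (w n - z) = (w m - z' - c) - (w n - z - c).
  by rewrite [in RHS]opprB [RHS]addrA subrK.
by rewrite (le_lt_trans (ler_normB _ _))// [e]splitr ltrD.
Qed.

Definition jointly_periodic (p q : nat) x := exists u v : nat,
  [/\ (0 < u)%N, (0 < v)%N, int_row (act (p ^ u)%:R x - x) &
      int_row (act (q ^ v)%:R x - x)].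

(** Were the orbit of [x] under [p] and then the orbit under [q] of a
periodic point x1 = p^k x both finite, a point q^l x1 of [A] would be
periodic under powers of both. *)
Lemma diff_set_clusters_at0 A p q : stable p A -> stable q A -> int_periodic A ->
  A !=set0 -> (forall x, A x -> ~ jointly_periodic p q x) ->
  clusters_at0 (diff_set A).
Proof.
move=> sp sq pA [x Ax] nper.
case: (orbit_recurrence sp pA Ax) => // -[k [u [u0]]].
rewrite addnC expnD natrM actM => px.
have Ax1 := stable_exp k sp Ax; set x1 := act _ x in Ax1 px.
case: (orbit_recurrence sq pA Ax1) => // -[l [v [v0]]].
rewrite addnC expnD natrM actM => qx.
have Ax2 := stable_exp l sq Ax1; case: (nper _ Ax2); exists u, v; split=> //.
by rewrite -actM mulrC actM -actB; exact: int_row_act.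
Qed.

Definition row_sum x := \sum_j x 0 j.

Lemma row_sumD x y : row_sum (x + y) = row_sum x + row_sum y.
Proof. by rewrite /row_sum -big_split; apply: eq_bigr => j _; rewrite mxE. Qed.

Lemma row_sum_axis j (a : R) : row_sum (axis j a) = a.
Proof.
rewrite /row_sum (bigD1 j)//= mxE eqxx big1 ?addr0// => i ij.
by rewrite mxE (negPf ij).
Qed.

Lemma row_sum_le x : `|row_sum x| <= d%:R * `|x|.
Proof. exact: le_trans (ler_norm_sum _ _ _) (l1norm_le x). Qed.

Lemma row_sum_int x : int_row x -> row_sum x \is a Num.int.
Proof. by move=> ix; rewrite rpred_sum. Qed.

(** Integers congruent to 1 modulo [N] fix the torsion point [e_j / N]. *)
Lemma act_axis_inv_int (P N : nat) j : (0 < P)%N -> (0 < N)%N -> P = 1 %[mod N] ->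
  int_row (act P%:R (axis j N%:R^-1) - axis j N%:R^-1 : 'rV[R]_d).
Proof.
move=> P0 N0 PN i; rewrite !mxE.
case: ifP => _; last by rewrite mulr0 subr0 rpred0.
have /dvdnP[k E] : (N %| P ^ i.+1 - 1)%N.
  by rewrite -eqn_mod_dvd ?expn_gt0 ?P0// -modnXm PN modnXm exp1n.
have -> : P%:R ^+ i.+1 * N%:R^-1 - N%:R^-1 = k%:R :> R.
  rewrite -[X in _ - X]mul1r -mulrBl -natrX -[1]/(1%:R) -natrB ?expn_gt0 ?P0// E.
  by rewrite natrM mulfK// pnatr_eq0 -lt0n.
exact: natr_int.
Qed.

(** One step passes from [B] to the points [x] of [B] with [x + e_j / N] in
[B], where [e_j / N] is a difference of points of [B].  The index [j] may change
from step to step, which does not matter because only coordinate sums are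
recorded. *)
Lemma boshernitzan_chain A p q N : mult_independent p q ->
  (0 < N)%N -> p = 1 %[mod N] -> q = 1 %[mod N] ->
  closed A -> int_periodic A -> stable p A -> stable q A -> A !=set0 ->
  (forall x, A x -> ~ jointly_periodic p q x) ->
  forall M : nat, exists B : set 'rV[R]_d,
    [/\ [/\ closed B, int_periodic B, stable p B & stable q B], B !=set0, B `<=` A &
      forall x i, B x -> (i <= M)%N ->
        exists2 y, A y & row_sum y = row_sum x + i%:R / N%:R].
Proof.
move=> ind N0 pN qN cA pA sp sq A0 nper.
have [p2 q2 _] := ind.
elim=> [|M [B [[cB pB spB sqB] B0 BA hB]]].
  exists A; split=> // x i Ax; rewrite leqn0 => /eqP ->.
  by exists x; rewrite // mul0r addr0.
have acc : clusters_at0 (diff_set B).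
  by apply: (diff_set_clusters_at0 spB sqB pB B0) => x /BA; exact: nper.
have [j hj] := stable_axis ind (closed_diff_set cB pB) (int_periodic_diff_set pB)
  (stable_diff_set spB) (stable_diff_set sqB) acc.
pose v : 'rV[R]_d := axis j N%:R^-1.
have shift n x : (0 < n)%N -> n = 1 %[mod N] -> stable n B ->
    B (x + v) -> B (act n%:R x + v).
  move=> n0 nN sn Bxv.
  have /(pB _ _ (sn _ Bxv)) := int_rowN (@act_axis_inv_int n N j n0 N0 nN).
  by rewrite actD opprB -addrA subrKC.
exists [set x | B x /\ B (x + v)]; split=> [||x [/BA]//|].
- split.
  + apply/closed_approxP => x hx; move/closed_approxP: cB => cB.
    split; apply: cB => e /hx[y [By Byv] xy]; first by exists y.
    by exists (y + v); rewrite // opprD addrACA subrr addr0.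
  + move=> x z [Bx Bxv] iz; split; first exact: pB.
    by rewrite addrAC; exact: pB.
  + by move=> x [Bx Bxv]; split; [exact: spB|apply: shift => //; exact: ltnW].
  + by move=> x [Bx Bxv]; split; [exact: sqB|apply: shift => //; exact: ltnW].
- by have [x Bx Bxv] := hj N%:R^-1; exists x.
- move=> x [|i] [Bx Bxv] iM; first by exists x; rewrite ?mul0r ?addr0//; exact: BA.
  have [y Ay Ey] := hB _ i Bxv iM; exists y => //.
  by rewrite Ey row_sumD row_sum_axis -natr1 mulrDl mul1r addrAC addrA.
Qed.

End Recurrence.

(** * Limit points of an orbit and density of its coordinate sums *)

Section LimitPoints.
Variables (R : realType) (d : nat).
Implicit Types (x y z v : 'rV[R]_d) (A E X : set 'rV[R]_d) (e : R).

Lemma int_periodic_limit_point A : int_periodic A -> int_periodic (limit_point A).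
Proof.
move=> pA x z /limit_point_approxP h iz; apply/limit_point_approxP => e /h.
move=> [y Ay [yx xy]]; exists (y + z); first exact: pA.
by rewrite (inj_eq (addIr z)) opprD addrACA subrr addr0.
Qed.

Lemma act_approx (n : nat) e : (0 < n)%N -> 0 < e -> exists2 h : R, 0 < h &
  forall x y, `|x - y| < h -> `|act n%:R x - act n%:R y| < e.
Proof.
move=> n0 e0; have nd : 0 < n%:R ^+ d :> R by rewrite exprn_gt0 ?ltr0n.
exists (e / n%:R ^+ d) => [|x y]; first exact: divr_gt0.
rewrite ltr_pdivlMr// mulrC -actB; apply: le_lt_trans.
by apply: norm_act; rewrite ler1n.
Qed.

Lemma stable_limit_point n A : (0 < n)%N -> stable n A -> stable n (limit_point A).
Proof.
move=> n0 sA x /limit_point_approxP lx; apply/limit_point_approxP => e e0.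
have [h h0 hh] := act_approx n0 e0; have [y Ay [yx xy]] := lx h h0.
exists (act n%:R y); first exact: sA.
split; last exact: hh.
by rewrite (inj_eq (act_inj _))// pnatr_eq0 -lt0n.
Qed.

Lemma stable_closure n A : (0 < n)%N -> stable n A -> stable n (closure A).
Proof.
move=> n0 sA x /closure_approxP cx; apply/closure_approxP => e e0.
have [h h0 hh] := act_approx n0 e0; have [y Ay xy] := cx h h0.
by exists (act n%:R y); [exact: sA|exact: hh].
Qed.

Lemma int_periodic_closure A : int_periodic A -> int_periodic (closure A).
Proof.
move=> pA x z /closure_approxP h iz; apply/closure_approxP => e /h[y Ay xy].
by exists (y + z); [exact: pA|rewrite opprD addrACA subrr addr0].
Qed.

Lemma irrational_mul_nat (a : R) (k : nat) :
  irrational a -> (0 < k)%N -> k%:R * a \isn't a Num.int.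
Proof.
move=> ia k0; apply/negP => /intrP[m Em]; apply: ia; exists (m%:~R / k%:R) => //.
rewrite rmorphM /= fmorphV /= ratr_int ratr_nat -Em mulrC mulKf//.
by rewrite pnatr_eq0 -lt0n.
Qed.

(** The orbit is lifted from the torus because [act n] is injective on the
space, which makes the set of limit points stable; on the torus it is not. *)
Definition orbit_lift (S : set nat) x : set 'rV[R]_d :=
  [set y | exists2 s, S s & int_row (y - act s%:R x)].

Lemma int_periodic_orbit_lift S x : int_periodic (orbit_lift S x).
Proof. by move=> y z [s Ss iy] iz; exists s => //; rewrite addrAC; exact: int_rowD. Qed.

Lemma stable_orbit_lift S x n : nat_semigroup S -> S n -> stable n (orbit_lift S x).
Proof.
move=> [_ mS] Sn y [s Ss iy]; exists (n * s)%N; first exact: mS.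
by rewrite natrM actM -actB; exact: int_row_act.
Qed.

Lemma semigroup_exp S n k : nat_semigroup S -> S n -> S (n ^ k.+1)%N.
Proof.
move=> [_ mS] Sn; elim: k => [|k IH]; first by rewrite expn1.
by rewrite expnS; exact: mS.
Qed.

(** Two powers of [p] cannot send [x] to the same point modulo the lattice, for
the j-th coordinate would be rational.  So a cluster point of the lifted
orbit is approached by points different from itself. *)
Lemma limit_point_orbit_lift S x p j : nat_semigroup S -> S p -> (1 < p)%N ->
  irrational (x 0 j) -> limit_point (orbit_lift S x) !=set0.
Proof.
move=> hS Sp p1 ix; pose w n := act (p ^ n.+1)%:R x.
have wE n z : int_row z -> orbit_lift S x (w n - z).
  move=> iz; exists (p ^ n.+1)%N; first exact: semigroup_exp.
  by rewrite addrAC subrr add0r; exact: int_rowN.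
have [c hc] := row_bolzano_weierstrass_mod1 w.
exists c; apply/limit_point_approxP => e e0.
have [n _ [z iz hz]] := hc _ 0%N e0.
have [E1|ne] := eqVneq (w n - z) c; last first.
  by exists (w n - z); [exact: wE|rewrite distrC].
have [m nm [z' iz' hz']] := hc _ n.+1 e0.
have [E2|ne] := eqVneq (w m - z') c; last first.
  by exists (w m - z'); [exact: wE|rewrite distrC].
have lt : ((p ^ n.+1) ^ j.+1 < (p ^ m.+1) ^ j.+1)%N by rewrite ltn_exp2r// ltn_exp2l.
have k0 : (0 < (p ^ m.+1) ^ j.+1 - (p ^ n.+1) ^ j.+1)%N by rewrite subn_gt0.
case/negP: (irrational_mul_nat ix k0).
have -> : ((p ^ m.+1) ^ j.+1 - (p ^ n.+1) ^ j.+1)%:R * x 0 j = (z' - z) 0 j.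
  have -> : z' - z = w m - w n.
    by rewrite -[w m](subrK z') -[w n](subrK z) E1 E2 opprD addrACA subrr add0r.
  by rewrite natrB ?(ltnW lt)// mulrBl !natrX !mxE !natrX.
exact: int_rowB.
Qed.

(** Translating [r] to the origin preserves stability under powers of [p] and
[q] that fix [r] modulo the lattice, and [stable_axis] applies. *)
Lemma jointly_periodic_limit_axis X p q r : mult_independent p q ->
  closed X -> int_periodic X -> stable p X -> stable q X ->
  limit_point X r -> jointly_periodic p q r ->
  exists j, forall a, X (r + axis j a).
Proof.
move=> ind /closed_approxP cX pX sp sq /limit_point_approxP lr.
move=> [u [v [u0 v0 ru rv]]].
pose B := [set y | X (r + y)].
have sB (P : nat) : stable P X -> int_row (act P%:R r - r) -> stable P B.
  move=> sP iP y /sP /pX-/(_ _ (int_rowN iP)).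
  by rewrite actD opprB [act _ r + _]addrC -addrA subrKC addrC.
have [j hj] : exists j, forall a, B (axis j a); last by exists j.
apply: (stable_axis (mult_independent_exp ind u0 v0)).
- apply/closed_approxP => x hx; apply: cX => e /hx[y By xy].
  by exists (r + y); rewrite // opprD addrACA subrr add0r.
- by move=> y z By iz; rewrite /B /= addrA; exact: pX.
- by apply: sB => //; exact: stable_exp.
- by apply: sB => //; exact: stable_exp.
move=> e /lr[y Xy [yr yx]]; exists (y - r); first by rewrite /B /= subrKC.
by rewrite subr_eq0 distrC.
Qed.

(** By [boshernitzan_chain] the sums of points of [A] meet all residues
row_sum x + i/N, for an arbitrarily large [N] coprime to [p] and [q]; by
Euler's theorem the exponent [totient N] makes the powers of [p] and [q]
congruent to 1. *)
Lemma aperiodic_row_sum_dense A p q : mult_independent p q ->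
  closed A -> int_periodic A -> stable p A -> stable q A -> A !=set0 ->
  (forall x, A x -> ~ jointly_periodic p q x) ->
  forall (a : R) e, 0 < e ->
  exists2 y, A y & exists m : int, `|row_sum y - a - m%:~R| < e.
Proof.
move=> ind cA pA sp sq A0 nper a e e0; have [p2 q2 _] := ind.
pose K := (Num.truncn e^-1).+1; pose N := (p * q * K + 1)%N.
have N0 : (0 < N)%N by rewrite /N addn1.
have pq0 : (0 < p * q)%N by rewrite muln_gt0 (ltnW p2) (ltnW q2).
have KN : (K <= N)%N by apply: leq_trans (leq_addr 1 _); exact: leq_pmull.
have Ne : N%:R^-1 < e.
  have ei : 0 < e^-1 by rewrite invr_gt0.
  rewrite -[ltRHS]invrK ltf_pV2 ?posrE ?ltr0n//.
  have /andP[_ h] := truncn_itv (ltW ei); apply: lt_le_trans h _.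
  by rewrite ler_nat.
have copN n k : coprime n (n * k + 1) by rewrite /coprime mulnC gcdnMDl gcdn1.
have pN : p ^ totient N = 1 %[mod N].
  by apply: Euler_exp_totient; rewrite /N -mulnA copN.
have qN : q ^ totient N = 1 %[mod N].
  by apply: Euler_exp_totient; rewrite /N [(p * q)%N]mulnC -mulnA copN.
have phi0 : (0 < totient N)%N by rewrite totient_gt0.
have nperN x : A x -> ~ jointly_periodic (p ^ totient N) (q ^ totient N) x.
  move=> Ax [u [v [u0 v0 ru rv]]]; apply: (nper x Ax).
  exists (totient N * u)%N, (totient N * v)%N; rewrite !muln_gt0 phi0.
  by rewrite !expnM.
have [B [_ [x Bx] _ hB]] := boshernitzan_chain (mult_independent_exp ind phi0 phi0)
  N0 pN qN cA pA (stable_exp _ sp) (stable_exp _ sq) A0 nperN N.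
pose t := a - row_sum x; pose f := t - (Num.floor t)%:~R.
have /andP[ft tf] := floor_itv t.
have f0 : 0 <= f by rewrite subr_ge0.
have NR : 0 < N%:R :> R by rewrite ltr0n.
have /andP[i1 i2] := truncn_itv (mulr_ge0 (ltW NR) f0).
set i := Num.truncn _ in i1 i2.
have iN : (i <= N)%N.
  rewrite -(ler_nat R) (le_trans i1)// -[leRHS]mulr1 ler_pM2l//.
  by move: tf; rewrite intrD1 -/f /f; lra.
have [y Ay Ey] := hB x i Bx iN; exists y => //; exists (- Num.floor t).
have -> : row_sum y - a - (- Num.floor t)%:~R = - ((N%:R * f - i%:R) / N%:R).
  rewrite Ey mulrNz /f /t; field; exact: lt0r_neq0.
apply: le_lt_trans Ne; rewrite normrN normrM normfV (gtr0_norm NR).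
rewrite -[leRHS]mul1r ler_pM2r ?invr_gt0// ger0_norm ?subr_ge0//.
by move: i2; rewrite -natr1; lra.
Qed.

Lemma orbit_row_sum_dense S x j : nat_semigroup S -> non_lacunary S ->
  irrational (x 0 j) -> forall (a : R) e, 0 < e ->
  exists2 y, closure (orbit_lift S x) y & exists m : int, `|row_sum y - a - m%:~R| < e.
Proof.
move=> hS [p [q [Sp Sq ind]]] ix a e e0; have [p2 q2 _] := ind.
have [p0 q0] : (0 < p)%N /\ (0 < q)%N by split; exact: ltnW.
set E := orbit_lift S x; set X := closure E; pose X' := limit_point X.
have cX : closed X by exact: closed_closure.
have pX : int_periodic X by apply/int_periodic_closure/int_periodic_orbit_lift.
have sX n : (0 < n)%N -> S n -> stable n X.
  by move=> n0 Sn; apply/stable_closure/stable_orbit_lift.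
have X'0 : X' !=set0.
  have [c /limit_point_approxP h] := limit_point_orbit_lift hS Sp p2 ix.
  exists c; apply/limit_point_approxP => r /h[y Ey ?]; exists y => //.
  exact: subset_closure.
have [[r [X'r rper]]|nper] := pselect (exists r, X' r /\ jointly_periodic p q r).
  have [i hi] := jointly_periodic_limit_axis ind cX pX (sX _ p0 Sp) (sX _ q0 Sq) X'r rper.
  exists (r + axis i (a - row_sum r)) => //; exists 0.
  by rewrite row_sumD row_sum_axis subrKC subrr subr0 normr0.
have cX' : closed X'.
  exact/limit_point_closed/hausdorff_accessible/norm_hausdorff.
have [||||||y X'y hy] := @aperiodic_row_sum_dense X' p q ind _ _ _ _ _ _ a e e0 => //.
- exact: int_periodic_limit_point.
- exact/stable_limit_point/sX.
- exact/stable_limit_point/sX.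
- by move=> y X'y yper; apply: nper; exists y.
exists y => //; move/closed_approxP: cX; apply => r r0.
by have /limit_point_approxP/(_ r r0)[z Xz [_ yz]] := X'y; exists z.
Qed.

End LimitPoints.

Lemma mod1_surj (R : realType) (o : circle R) : exists x : R, mod1 x = o.
Proof. by exists (repr o); rewrite /mod1 reprK. Qed.

Theorem theorem3 (R : realType) (Sigma : set nat) (P : {poly R})
  (hSigma : nat_semigroup Sigma) (hlac : non_lacunary Sigma)
  (hP : exists j : nat, (1 <= j)%N /\ irrational P`_j) :
  dense [set mod1 P.[s%:R] | s in Sigma].
Proof.
have [[|j] [// _ irr]] := hP.
pose d := size P.
have jd : (j < d)%N.
  rewrite ltnNge; apply/negP => dj; apply: irr; exists 0 => //.
  by rewrite rmorph0 nth_default// leqW.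
pose al : 'rV[R]_d := \row_i P`_i.+1.
have PE (t : R) : P.[t] = P`_0 + row_sum (act t al).
  rewrite (@horner_coef_wide _ d.+1) ?leqnSn// big_ord_recl expr0 mulr1.
  by congr (_ + _); apply: eq_bigr => i _; rewrite !mxE mulrC.
move=> U [c Uc] oU; have [y yc] := mod1_surj c.
have /nbhs_ballP[e /= e0 eU] : nbhs y (@mod1 R @^-1` U).
  by apply: mod1_continuous; rewrite yc; exact: open_nbhs_nbhs.
have e2 : 0 < e / 2 by rewrite divr_gt0.
have irra : irrational (al 0 (Ordinal jd)) by rewrite mxE.
have [x clx [m xm]] := orbit_row_sum_dense hSigma hlac irra (y - P`_0) e2.
have ed : 0 < e / 2 / d.+1%:R by rewrite divr_gt0.
have [w [s Ss iw] xw] := (closure_approxP _ _).1 clx _ ed.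
exists (mod1 P.[s%:R]); split; last by exists s.
have -> : mod1 P.[s%:R] = mod1 (P`_0 + row_sum w - m%:~R).
  apply/mod1_eq; rewrite PE.
  have -> : P`_0 + row_sum (act s%:R al) - (P`_0 + row_sum w - m%:~R) =
      m%:~R - row_sum (w - act s%:R al).
    have := row_sumD (w - act s%:R al) (act s%:R al); rewrite subrK => ->.
    by ring.
  by rewrite rpredB ?intr_int ?row_sum_int.
apply: eU; rewrite -ball_normE /=.
have -> : y - (P`_0 + row_sum w - m%:~R) =
    row_sum (x - w) - (row_sum x - (y - P`_0) - m%:~R).
  have := row_sumD (x - w) w; rewrite subrK => ->.
  by ring.
rewrite (le_lt_trans (ler_normB _ _))// [e]splitr ltrD//.
apply: le_lt_trans (row_sum_le _) _.
apply: (@le_lt_trans _ _ (d.+1%:R * `|x - w|)); first by rewrite ler_wpM2r// ler_nat.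
by rewrite mulrC -ltr_pdivlMr.
Qed.
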